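(* Let $r$ and $k$ be integers with $3\le r\le k$, let $G$ be a graph, and let $e\in E(G)$. If $G$ is not $k$-colorable but $G-e$ is $k$-colorable, then $G-e$ contains at least $\frac12\prod_{i=1}^{r-1}(k-i)$ cycles whose lengths are divisible by $r$ (none of which contain $e$).
   Context: Graphs are finite, simple and undirected. $G-e$ denotes the graph obtained from $G$ by deleting the edge $e$ (keeping all vertices). A graph is $k$-colorable if its vertices can be assigned colors from a set of $k$ colors so that adjacent vertices receive distinct colors. Cycles are counted as subgraphs (without a chosen starting vertex or direction), and the length of a cycle is its number of edges. *)

(* Defs.v *)
From mathcomp Require Import all_boot.

Set Implicit Arguments.
Unset Strict Implicit.
Unset Printing Implicit Defensive.

Record sgraph := SGraph {
  vertex :> finType;
  edges : {set {set vertex}};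
  edges_card2 : forall e : {set vertex}, e \in edges -> #|e| = 2
}.

Definition adj (G : sgraph) : rel G :=
  [rel u v | [set u; v] \in edges G].

Lemma delete_edge_card2 (G : sgraph) (e f : {set G}) :
  f \in edges G :\ e -> #|f| = 2.
Proof. by case/setD1P=> _ /edges_card2. Qed.

Definition delete_edge (G : sgraph) (e : {set G}) : sgraph :=
  SGraph (@delete_edge_card2 G e).

Definition colorable (k : nat) (G : sgraph) : Prop :=
  exists c : G -> 'I_k, forall u v : G, adj u v -> c u <> c v.

(* A cycle has no isolated vertices, so as a subgraph it is determined by its
   edge set C; its length is #|C|. *)
Definition is_cycle (G : sgraph) (C : {set {set G}}) : Prop :=
  exists p : seq G,
    [/\ 3 <= size p, uniq p, cycle (@adj G) p
      & C = [set [set x; next p x] | x in p]].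

(* Main.v *)
Require Import Defs.
From mathcomp Require Import all_boot all_order all_algebra.

(** Write [e = xy] and fix a proper [k]-coloring [c] of [G - e]. Since [G] has no
    proper [k]-coloring, every proper [k]-coloring of [G - e] gives [x] and [y]
    the same color; put [a = c x = c y].

    Take a cyclic order [s] of [r] colors, one of them [a]; there are
    [(k-1)(k-2)...(k-r+1)] of these. Orient an edge [uv] of [G - e] from [u] to
    [v] when [c v] is the successor of [c u] in [s], and call the resulting
    digraph [D]. Replacing each color of [s] by its successor on all the vertices
    that can be reached in [D] from a given vertex yields a proper coloring again
    ([rotate_from_proper]): an edge leaving the reachable set could become
    monochromatic only if it were an arc of [D]. If [y] were not reachable from
    [x], then rotating from [x] would change the color of [x] but not that of
    [y], which is impossible; by symmetry [x] is reachable from [y] too, and so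
    [D] has a directed cycle ([closed_walk_cycle]).

    Along such a cycle the colors run through [s] again and again, so its length
    is a multiple of [r] ([dvdn_size_rotation_cycle]), and [c] maps its edge set
    onto the edge set of the cycle [s] on the colors
    ([color_rotation_cycle_edges]). As an undirected cycle determines its cyclic
    order up to reversal ([cycle_edges_inj_rev]), no cycle of [G - e] is obtained
    from more than two cyclic orders [s]. Hence there are at least half as many
    cycles as cyclic orders. *)

Set Implicit Arguments.
Unset Strict Implicit.
Unset Printing Implicit Defensive.

(** * Cyclic sequences and their edge sets *)

Section CyclicSequences.
Variable T : finType.
Implicit Types (s t : seq T) (x y z : T).

Definition cycle_edges s : {set {set T}} := [set [set x; next s x] | x in s].

Lemma next_neq s x : uniq s -> 1 < size s -> x \in s -> next s x != x.
Proof.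
move=> Us szs /rot_to[i t def_s].
move: Us szs; rewrite -(size_rot i) -(rot_uniq i) => Us szs.
rewrite -(next_rot i); last by rewrite -(rot_uniq i).
move: Us szs; rewrite def_s; case: t {def_s} => [|y t] //=.
by rewrite inE eqxx eq_sym => /andP[/norP[]].
Qed.

Lemma next_next_neq s x :
  uniq s -> 2 < size s -> x \in s -> next s (next s x) != x.
Proof.
move=> Us szs /rot_to[i t def_s].
move: (Us) szs; rewrite -(size_rot i) -(rot_uniq i) => Us' szs.
rewrite -!(next_rot i Us).
move: Us' szs; rewrite def_s; case: t {def_s} => [|y [|z t]] //=.
rewrite !inE !eqxx !negb_or => /and3P[/and3P[xy xz _] _ _] _.
by rewrite [y == x]eq_sym (negbTE xy) /= ?eqxx eq_sym.
Qed.

Lemma set2_inj x z u v :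
  [set x; z] = [set u; v] -> (x = u /\ z = v) \/ (x = v /\ z = u).
Proof.
move=> eqS.
have /set2P xuv : x \in [set u; v] by rewrite -eqS set21.
have /set2P zuv : z \in [set u; v] by rewrite -eqS set22.
have /set2P uxz : u \in [set x; z] by rewrite eqS set21.
have /set2P vxz : v \in [set x; z] by rewrite eqS set22.
by case: xuv zuv uxz vxz => -> [] -> [] ? [] ?; auto.
Qed.

Lemma mem_cycle_edges s x z :
  [set x; z] \in cycle_edges s ->
  x \in s /\ (z = next s x \/ z \in s /\ x = next s z).
Proof.
case/imsetP=> u us /set2_inj[[-> ->]|[-> ->]]; first by split; [|left].
by split; [rewrite mem_next | right].
Qed.

Lemma cycle_edges_next s x : x \in s -> [set x; next s x] \in cycle_edges s.
Proof. exact: imset_f. Qed.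

Lemma card_cycle_edges s : uniq s -> 2 < size s -> #|cycle_edges s| = size s.
Proof.
move=> Us szs; rewrite card_in_imset; first exact/card_uniqP.
move=> x y xs ys /set2_inj[[]//|[xE yE]].
by have := next_next_neq Us szs ys; rewrite -xE yE eqxx.
Qed.

(** All entries lie on one orbit of [next], so a property that [next] preserves
    needs checking at one entry only. *)
Lemma next_ind s (P : T -> Prop) b :
    uniq s -> b \in s -> P b ->
    (forall x, x \in s -> P x -> P (next s x)) ->
  forall x, x \in s -> P x.
Proof.
move=> Us bs Pb IH x.
rewrite -(fconnect_cycle (cycle_next Us) bs) => /iter_findex <-.
suff [_ //]: iter (findex (next s) b x) (next s) b \in s
             /\ P (iter (findex (next s) b x) (next s) b).
elim: (findex _ _ _) => //= n [ins Pn].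
by rewrite mem_next; split; last exact: IH.
Qed.

(** Walking along a cycle never backtracks, and each vertex lies on two edges
    only; so one common step forces all later steps to agree. *)
Lemma cycle_edges_eq_next s t b :
    uniq s -> uniq t -> 2 < size t -> cycle_edges s = cycle_edges t ->
    b \in s -> next t b = next s b ->
  {in s, next t =1 next s}.
Proof.
move=> Us Ut szt eqE bs eqb.
apply: (next_ind Us bs eqb) => x xs eqx.
have xt : x \in t.
  by case: (@mem_cycle_edges t x (next s x)); rewrite // -eqE cycle_edges_next.
have : [set next s x; next t (next s x)] \in cycle_edges s.
  by rewrite eqE cycle_edges_next // -eqx mem_next.
case/mem_cycle_edges=> _ [//|[_ /(can_inj (prev_next Us)) xE]].
by have := next_next_neq Ut szt xt; rewrite eqx -xE eqxx.
Qed.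

Lemma eq_next_eq a s t :
    uniq (a :: s) -> uniq (a :: t) -> size s = size t ->
    {in a :: s, next (a :: t) =1 next (a :: s)} ->
  s = t.
Proof.
move=> Us Ut eqsz.
have: fpath (next (a :: s)) a s.
  by have := cycle_next Us; rewrite /= rcons_path => /andP[].
have: fpath (next (a :: t)) a t.
  by have := cycle_next Ut; rewrite /= rcons_path => /andP[].
move: {Us Ut}(next (a :: t)) (next (a :: s)) => f g.
elim: s t a eqsz => [|x s IHs] [|y t] a //= [eqsz].
case/andP=> /eqP <- fp /andP[/eqP <- gp] eqfg.
have eqa: f a = g a by apply: eqfg; rewrite mem_head.
rewrite eqa in fp *; congr (_ :: _).
by apply: IHs fp gp _ => // z zs; apply: eqfg; rewrite in_cons zs orbT.
Qed.

Lemma next_cons_rev a t :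
  uniq (a :: t) -> next (a :: rev t) =1 prev (a :: t).
Proof.
move=> Us x; rewrite -(next_rev Us) rev_cons -rot1_cons next_rot //.
by rewrite /= mem_rev rev_uniq.
Qed.

Lemma cycle_edges_rev a t :
  uniq (a :: t) -> cycle_edges (a :: rev t) = cycle_edges (a :: t).
Proof.
move=> Us; apply/setP=> E; apply/imsetP/imsetP=> -[x xs ->].
  have xs' : x \in a :: t by move: xs; rewrite !inE mem_rev.
  exists (prev (a :: t) x); first by rewrite mem_prev.
  by rewrite next_prev // next_cons_rev // setUC.
exists (next (a :: t) x); last by rewrite next_cons_rev // prev_next // setUC.
by move: xs; rewrite -mem_next !inE mem_rev.
Qed.

(** At the common starting point [a] the two cycles use the same two edges: they
    leave along the same one, or one of them leaves where the other returns. *)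
Lemma cycle_edges_inj_rev a s t :
    uniq (a :: s) -> uniq (a :: t) -> size s = size t -> 1 < size t ->
    cycle_edges (a :: s) = cycle_edges (a :: t) ->
  t = s \/ t = rev s.
Proof.
move=> Us Ut eqsz szt eqE.
have Ur : uniq (a :: rev s) by rewrite /= mem_rev rev_uniq.
have : [set a; next (a :: t) a] \in cycle_edges (a :: s).
  by rewrite eqE cycle_edges_next // mem_head.
case/mem_cycle_edges=> _ [eqa|[_ eqa]]; [left|right]; apply/esym.
  apply: (eq_next_eq Us Ut eqsz).
  exact: (cycle_edges_eq_next Us Ut _ eqE (mem_head _ _) eqa).
apply: (eq_next_eq Ur Ut); first by rewrite size_rev.
apply: (cycle_edges_eq_next Ur Ut _ _ (mem_head _ _)) => //.
  by rewrite cycle_edges_rev.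
by rewrite next_cons_rev //; exact/esym/(canLR (prev_next Us) eqa).
Qed.

End CyclicSequences.

(** * Directed cycles *)

Lemma closed_walk_cycle (T : finType) (d : rel T) x y :
    x != y -> connect d x y -> connect d y x ->
  exists p, [/\ p != [::], uniq p & cycle d p].
Proof.
move=> nxy /connectP[[|z p] /= dp yE] dyx; first by rewrite yE eqxx in nxy.
case/andP: dp => dxz dp.
have /connectP[q0 dq0 xE0] : connect d z x.
  by apply: connect_trans dyx; apply/connectP; exists p.
(* A simple path back to [x], closed up by the first arc of the walk. *)
case/shortenP: dq0 xE0 => q dq Uq _ xE.
by exists (z :: q); rewrite /= rcons_path dq -xE.
Qed.

(** * Rotating colors *)

Section Rotation.
Variables (T K : finType) (e : rel T) (c : T -> K) (s : seq K).
Hypotheses (e_sym : symmetric e) (c_proper : forall u v, e u v -> c u <> c v).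
Hypothesis (Us : uniq s).

Definition rotation_arc : rel T := [rel u v | e u v && (c v == next s (c u))].

Definition rotate_from w v : K :=
  if connect rotation_arc w v then next s (c v) else c v.

Lemma rotate_from_proper w u v : e u v -> rotate_from w u <> rotate_from w v.
Proof.
have boundary u' v' : e u' v' -> connect rotation_arc w u' ->
    ~~ connect rotation_arc w v' -> next s (c u') <> c v'.
  move=> euv cu /negP ncv eqc; apply/ncv/(connect_trans cu)/connect1.
  by rewrite /rotation_arc /= euv eqc eqxx.
move=> euv; rewrite /rotate_from.
case: ifPn => cu; case: ifPn => cv.
- by move/(can_inj (prev_next Us)); apply: c_proper.
- exact: boundary cv.
- by move/esym; apply: boundary cu; rewrite // e_sym.
- exact: c_proper.
Qed.

(** When no proper coloring separates [x] from [y], each of the two is reachable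
    from the other, for otherwise rotating would separate them. *)
Lemma rotation_cycle_exists x y :
    (forall c' : T -> K, (forall u v, e u v -> c' u <> c' v) -> c' x = c' y) ->
    x != y -> c x \in s -> 1 < size s ->
  exists p, [/\ p != [::], uniq p & cycle rotation_arc p].
Proof.
move=> same nxy cxs szs; have cxy := same c c_proper.
have moved : next s (c x) != c x by apply: next_neq.
apply: (closed_walk_cycle nxy).
  have := same _ (@rotate_from_proper x).
  rewrite /rotate_from connect0; case: ifP => // _ /eqP.
  by rewrite -cxy (negbTE moved).
have := same _ (@rotate_from_proper y).
rewrite /rotate_from connect0; case: ifP => // _ /esym/eqP.
by rewrite -cxy (negbTE moved).
Qed.

Lemma rotation_arc_color u v : rotation_arc u v -> c v = next s (c u).
Proof. by case/andP=> _ /eqP. Qed.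

(** Off [s] the function [next s] is the identity, and no edge joins two vertices
    of the same color. *)
Lemma rotation_arc_mem u v : rotation_arc u v -> c u \in s.
Proof.
case/andP=> euv /eqP cv; apply: contraT => cus.
case: (c_proper euv); rewrite cv next_nth.
by rewrite (negbTE cus).
Qed.

Lemma index_next b :
  b \in s -> index (next s b) s = (index b s).+1 %[mod size s].
Proof.
move=> bs; rewrite next_nth bs; case: s Us bs => // a t Ut.
rewrite -index_mem ltnS; set i := index b _; rewrite leq_eqVlt.
case/orP=> [/eqP -> | lt_it].
  by rewrite nth_default // index_head modnn mod0n.
by rewrite -[nth a t i]/(nth a (a :: t) i.+1) index_uniq.
Qed.

Lemma index_rotation_path u p :
    path rotation_arc u p ->
  index (c (last u p)) s = index (c u) s + size p %[mod size s].
Proof.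
elim: p u => [|v p IHp] u /=; first by rewrite addn0.
case/andP=> duv /IHp->; rewrite (rotation_arc_color duv).
rewrite -modnDml (index_next (rotation_arc_mem duv)) modnDml.
by rewrite addSnnS.
Qed.

Lemma dvdn_size_rotation_cycle p : cycle rotation_arc p -> size s %| size p.
Proof.
case: p => [|u p] // /index_rotation_path.
rewrite last_rcons size_rcons /= -[in LHS](addn0 (index _ _)) => /eqP.
by rewrite eqn_modDl mod0n eq_sym.
Qed.

(** Starting at any vertex of the cycle and following it, one meets the colors of
    [s] in their cyclic order, so all of them occur. *)
Lemma color_rotation_cycle_edges p :
    p != [::] -> cycle rotation_arc p ->
  [set c @: E | E : {set T} in cycle_edges p] = cycle_edges s.
Proof.
move=> p0 dp.
have cnext x : x \in p -> c (next p x) = next s (c x).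
  by move/(next_cycle dp)/rotation_arc_color.
have cmem x : x \in p -> c x \in s.
  by move/(next_cycle dp)/rotation_arc_mem.
have imE x : x \in p -> c @: [set x; next p x] = [set c x; next s (c x)].
  by move=> xp; rewrite imsetU1 imset_set1 cnext.
have [u up] : exists u, u \in p.
  by case: p p0 {dp cnext cmem imE} => // u p _; exists u; rewrite mem_head.
have csurj : forall b, b \in s -> exists2 x, x \in p & c x = b.
  apply: (next_ind Us (cmem u up)); first by exists u.
  by move=> _ _ [x xp <-]; exists (next p x); rewrite ?mem_next ?cnext.
apply/setP=> E; apply/imsetP/imsetP.
  by case=> F /imsetP[x xp ->] ->; exists (c x); rewrite ?cmem ?imE.
case=> b /csurj[x xp <-] ->; exists [set x; next p x]; last by rewrite imE.
exact: imset_f.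
Qed.

End Rotation.

(** * Counting *)

Lemma leq_card_fibers (aT rT : finType) (A : {set aT}) (f : aT -> rT) n :
    (forall y, y \in f @: A -> #|[set x in A | f x == y]| <= n) ->
  #|A| <= n * #|f @: A|.
Proof.
move=> fib; rewrite -sum1_card (partition_big_imset f) /= mulnC -sum_nat_const.
apply: leq_sum => y yfA; apply: leq_trans _ (fib y yfA).
by rewrite sum1_card; apply: eq_leq; apply: eq_card => x; rewrite !inE.
Qed.

Lemma natr_ffact_prod k r :
  0 < r -> r <= k ->
  (\prod_(1 <= i < r) (k%:R - i%:R) = ((k.-1 ^_ r.-1)%:R : rat))%R.
Proof.
case: r k => [|r] [|k] // _ le_rk.
rewrite big_add1 big_mkord /= ffact_prod GRing.natr_prod.
apply: eq_bigr => i _; rewrite -GRing.natrB ?subSS //.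
exact: ltn_trans (ltn_ord i) le_rk.
Qed.

Lemma card_cyclic_orders k n (a : 'I_k) :
  #|[set t : n.-tuple 'I_k | uniq (a :: t)]| = k.-1 ^_ n.
Proof.
rewrite -[k in k.-1]card_ord -(cardC1 a) -card_uniq_tuples.
apply: eq_card => t; rewrite !inE /=; congr (_ && _).
by rewrite -has_pred1 -all_predC; apply: eq_all => x; rewrite !inE.
Qed.

Lemma adj_sym (G : sgraph) : symmetric (@adj G).
Proof. by move=> u v; rewrite /adj /= setUC. Qed.

(** A coloring of the edge-deleted graph that separates the two ends of the deleted
    edge would be proper on the whole graph. *)
Lemma delete_edge_same_color k (G : sgraph) (x y : G)
    (c : G -> 'I_k) :
    ~ colorable k G ->
    (forall u v : delete_edge [set x; y], adj u v -> c u <> c v) ->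
  c x = c y.
Proof.
move=> nG cH; apply/eqP/contraT => /eqP nc; case: nG; exists c => u v uv.
have [/set2_inj[[-> ->]|[-> ->]]|nuv] := eqVneq [set u; v] [set x; y] => //.
  by move/esym.
by apply: cH; rewrite /adj /= in_setD1 nuv.
Qed.

Theorem theorem3 (r k : nat) (G : sgraph) (e : {set G}) :
  3 <= r -> r <= k ->
  e \in edges G ->
  ~ colorable k G ->
  colorable k (delete_edge e) ->
  exists S : {set {set {set delete_edge e}}},
    (forall C : {set {set delete_edge e}}, C \in S ->
       [/\ is_cycle C, r %| #|C| & e \notin C]) /\
    (2%:R^-1 * \prod_(1 <= i < r) (k%:R - i%:R) <= #|S|%:R :> rat)%R.
Proof.
move=> r3 rk eG nG [c cH].
have r0 : 0 < r by exact: leq_trans r3.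
have /eqP/cards2P[x [y [nxy eE]]] := edges_card2 eG; subst e.
set H := delete_edge _ in c cH *.
pose a := c x.
pose D (t : r.-1.-tuple 'I_k) := rotation_arc (@adj H) c (a :: t).
have sz_t (t : r.-1.-tuple 'I_k) : size (a :: t) = r.
  by rewrite /= size_tuple prednK.
have [p_ p_P] : exists p_ : r.-1.-tuple 'I_k -> seq H,
    forall t : r.-1.-tuple 'I_k,
    uniq (a :: t) -> [/\ p_ t != [::], uniq (p_ t) & cycle (D t) (p_ t)].
  apply: (@fin_all_exists _ (fun=> seq H)
    (fun (t : r.-1.-tuple 'I_k) p => uniq (a :: t) ->
       [/\ p != [::], uniq p & cycle (D t) p])) => t.
  have [Ut|_] := boolP (uniq (a :: t)); last by exists [::].
  have [|||p pP] := @rotation_cycle_exists _ _ _ c (a :: t)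
      (@adj_sym H) cH Ut x y _ nxy; last by exists p.
  - by move=> c' c'H; apply: (delete_edge_same_color nG).
  - exact: mem_head.
  - by rewrite sz_t; exact: leq_trans r3.
pose A := [set t : r.-1.-tuple 'I_k | uniq (a :: t)].
pose edges_of t := cycle_edges (p_ t).
exists (edges_of @: A); split.
  move=> _ /imsetP[t /[!inE] Ut ->]; have [p0 Up dp] := p_P t Ut.
  have dvd_r : r %| size (p_ t).
    by rewrite -(sz_t t); apply: (dvdn_size_rotation_cycle cH Ut).
  have sz_p : 2 < size (p_ t).
    by apply: leq_trans r3 (dvdn_leq _ dvd_r); rewrite lt0n size_eq0.
  have adj_p : cycle (@adj H) (p_ t).
    by apply: sub_cycle dp => u v /andP[].
  split; first by exists (p_ t).
  - by rewrite card_cycle_edges.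
  - apply/imsetP=> -[u up eE].
    by have := next_cycle adj_p up; rewrite /adj /= -eE setD11.
rewrite natr_ffact_prod // GRing.mulrC Num.Theory.ler_pdivrMr //.
rewrite -GRing.natrM Num.Theory.ler_nat mulnC -(card_cyclic_orders r.-1 a).
apply: leq_card_fibers => _ /imsetP[t /[!inE] Ut ->].
(* The color pairs seen along the edges of a cycle recover its cyclic order up to
   reversal, so the fiber of [t] is contained in [{t, rev t}]. *)
apply: leq_trans (_ : #|[set t; [tuple of rev t]]| <= 2); last first.
  by rewrite cards2; case: eqP.
apply/subset_leq_card/subsetP=> t' /[!inE] /andP[Ut' /eqP eqE].
have [p0 _ dp] := p_P t Ut; have [p0' _ dp'] := p_P t' Ut'.
have [|||eqt|eqt] := cycle_edges_inj_rev Ut Ut'.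
- by rewrite !size_tuple.
- by rewrite size_tuple -ltnS prednK.
- rewrite -(color_rotation_cycle_edges cH Ut p0 dp).
  rewrite -(color_rotation_cycle_edges cH Ut' p0' dp').
  by rewrite -/(edges_of t) -/(edges_of t') eqE.
- by rewrite -val_eqE /= eqt eqxx.
- by rewrite -[t' == [tuple of rev t]]val_eqE /= eqt eqxx orbT.
Qed.
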